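(* Let $R$ be a binary relation on $\boldsymbol\beta\omega$ with ${\le_{\mathrm{RK}}}\subseteq R\subseteq{\le_{\mathrm C}}$. Then $(\boldsymbol\beta\omega,R)$ is universal for partially ordered sets that are locally at most countable and have cardinality at most $\aleph_1$; that is, for every partially ordered set $(X,\le)$ with $|X|\le\aleph_1$ such that $\{y\in X:y\le x\}$ is at most countable for every $x\in X$, there is an injective map $e:X\to\boldsymbol\beta\omega$ such that for all $x,y\in X$, $x\le y$ iff $e(x)\,R\,e(y)$.
   Context: $\boldsymbol\beta\omega$ is the set of all ultrafilters over $\omega$ (principal ones included), topologized by the basic open sets $\{\mathfrak u:A\in\mathfrak u\}$, $A\subseteq\omega$. For a map $f$ of $\omega$ into a compact Hausdorff space $K$, $\widetilde f:\boldsymbol\beta\omega\to K$ is its unique continuous extension. Rudin–Keisler preorder: $\mathfrak u\le_{\mathrm{RK}}\mathfrak v$ iff there is $f:\omega\to\omega$ with $\widetilde f(\mathfrak v)=\mathfrak u$. Comfort preorder: a Tychonoff space $X$ is $\mathfrak u$-compact iff for every $f:\omega\to X$ one has $\widetilde f(\mathfrak u)\in X$, where $\widetilde f:\boldsymbol\beta\omega\to\boldsymbol\beta X$ and $\boldsymbol\beta X\supseteq X$ is the Čech–Stone compactification; $\mathfrak u\le_{\mathrm C}\mathfrak v$ iff every $\mathfrak v$-compact (Tychonoff) space is $\mathfrak u$-compact. One has ${\le_{\mathrm{RK}}}\subseteq{\le_{\mathrm C}}$. *)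

(* Defs.v *)
From HB Require Import structures.
From mathcomp Require Import all_boot all_order all_algebra.
From mathcomp Require Import all_classical all_reals all_analysis.

Set Implicit Arguments.
Unset Strict Implicit.
Unset Printing Implicit Defensive.

Import Order.TTheory GRing.Theory Num.Theory.
Import numFieldNormedType.Exports.

Local Open Scope classical_set_scope.
Local Open Scope card_scope.
Local Open Scope ring_scope.

Record betaomega := BetaOmega {
  ultra_sets : set_system nat;
  ultra_setsP : UltraFilter ultra_sets }.

#[global] Existing Instance ultra_setsP.

HB.instance Definition _ := gen_eqMixin betaomega.
HB.instance Definition _ := gen_choiceMixin betaomega.

Definition basic_open (A : set nat) : set betaomega := [set u | ultra_sets u A].

Lemma basic_open_cover :
  \bigcup_(A in [set: set nat]) basic_open A = [set: betaomega].
Proof. by apply/seteqP; split=> // u _; exists setT => //; exact: filterT. Qed.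

Lemma basic_open_join (A B : set nat) (u : betaomega) :
  [set: set nat] A -> [set: set nat] B -> basic_open A u -> basic_open B u ->
  exists C, [/\ [set: set nat] C, basic_open C u &
                basic_open C `<=` basic_open A `&` basic_open B].
Proof.
move=> _ _ uA uB; exists (A `&` B); split=> //; first exact: filterI.
by move=> v vAB; split; move: vAB; apply: filterS => n [].
Qed.

HB.instance Definition _ :=
  isBaseTopological.Build betaomega basic_open_cover basic_open_join.

Lemma open_basic_open (A : set nat) : open (basic_open A).
Proof.
by exists [set A] => //; rewrite bigcup_set1.
Qed.

Lemma nbhs_betaomegaP (u : betaomega) (V : set betaomega) :
  nbhs u V <-> exists2 A, ultra_sets u A & basic_open A `<=` V.
Proof.
rewrite nbhsE; split=> [[W [[D _ <-] [A DA uA]] WV]|[A uA AV]].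
  by exists A => // v vA; apply: WV; exists A.
by exists (basic_open A) => //; split=> //; exact: open_basic_open.
Qed.

Lemma betaomega_hausdorff : hausdorff_space betaomega.
Proof.
move=> u v cl.
have uv : ultra_sets v `<=` ultra_sets u.
  move=> A vA; have [//|uA] := in_ultra_setVsetC A (ultra_setsP u).
  have [||w [/= wA wnA]] := cl (basic_open (~` A)) (basic_open A).
  - by apply/nbhs_betaomegaP; exists (~` A).
  - by apply/nbhs_betaomegaP; exists A.
  by have [n []] := filter_ex (filterI wA wnA).
have := @max_filter _ _ (ultra_setsP v) _ _ uv.
case: u v {cl uv} => [u uU] [v vU] /= E; case: _ / E vU => vU.
by congr BetaOmega; exact: Prop_irrelevance.
Qed.

Lemma betaomega_compact : compact [set: betaomega].
Proof.
rewrite compact_ultra => F FU _.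
pose U : set_system nat := [set A | F (basic_open A)].
have UP : ProperFilter U.
  suff UF : Filter U.
    split=> //; rewrite /U /= => F0; have [w w0] := @filter_ex _ F _ _ F0.
    by have [] := @filter_ex _ (ultra_sets w) _ _ w0.
  split; rewrite /U /=.
  - by apply: (@filterS _ F _ setT) => [w _|]; exact: filterT.
  - move=> A B FA FB; apply: (@filterS _ F _ _ _ _ (@filterI _ F _ _ _ FA FB)).
    by move=> w [wA wB]; exact: filterI.
  - by move=> A B AB; apply: (@filterS _ F) => w; exact: filterS.
have UU : UltraFilter U.
  split=> // G GP UG; apply/seteqP; split=> // A GA.
  have [//|FnA] := in_ultra_setVsetC (basic_open A) FU.
  have /UG GnA : U (~` A).
    apply: filterS FnA => w wA; have [//|//] := in_ultra_setVsetC A (ultra_setsP w).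
  by have [n []] := filter_ex (filterI GA GnA).
exists (BetaOmega UU); split=> // V /nbhs_betaomegaP[A UA AV].
exact: filterS AV _.
Qed.

Definition principal (n : nat) : betaomega :=
  BetaOmega (principal_filter_ultra n).

(** [is_stone_ext f F]: [F] is the continuous extension of [f] to the space of
    ultrafilters.  It exists and is unique when [K] is compact Hausdorff, by
    [stone_ext_exists] and [stone_ext_unique]; below it is used only for
    [K := betaomega] and [K := stone_cech _ _], which are compact Hausdorff. *)
Definition is_stone_ext (K : topologicalType) (f : nat -> K)
    (F : betaomega -> K) : Prop :=
  continuous F /\ forall n, F (principal n) = f n.

Lemma ultra_fmap (T : Type) (f : nat -> T) (u : betaomega) :
  UltraFilter (f @ ultra_sets u).
Proof.
split=> [|G GP uG]; first exact: fmap_proper_filter.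
apply/seteqP; split=> // A GA.
have [//|uA] := in_ultra_setVsetC (f @^-1` A) (ultra_setsP u).
have GnA : G (~` A) by apply: uG.
by have [n []] := filter_ex (filterI GA GnA).
Qed.

Lemma stone_ext_exists (K : topologicalType) (f : nat -> K) :
  hausdorff_space K -> compact [set: K] ->
  exists F, is_stone_ext f F /\ forall u, f @ ultra_sets u --> F u.
Proof.
move=> hK cK.
have cvF (u : betaomega) : exists p : K, f @ ultra_sets u --> p.
  have := cK; rewrite compact_ultra.
  by move=> /(_ _ (ultra_fmap f u) filterT)[p [_ fp]]; exists p.
have [F FP] := choice cvF.
exists F; split=> //; split=> [u V FuV|n].
  have [|W FW cWV] := @compact_regular K (F u) _ hK cK _ V FuV; first exact: filterT.
  apply/nbhs_betaomegaP; exists (f @^-1` W); first exact: FP.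
  move=> v vW; apply: cWV => B /FP vB.
  have [n [? ?]] := filter_ex (filterI vW vB); by exists (f n).
apply: hK => A B /= nA nB.
have {nA} := FP _ _ nA; move/principal_filterP => /= fA.
by exists (f n); split=> //; exact: nbhs_singleton.
Qed.

Lemma stone_ext_unique (K : topologicalType) (f : nat -> K)
    (F G : betaomega -> K) :
  hausdorff_space K -> is_stone_ext f F -> is_stone_ext f G -> F = G.
Proof.
move=> hK [cF fF] [cG fG]; apply/funext => u; apply: hK => A B FA GB.
have /nbhs_betaomegaP[C uC CA] := cF u A FA.
have /nbhs_betaomegaP[D uD DB] := cG u B GB.
have [n [Cn Dn]] := filter_ex (filterI uC uD).
exists (f n); split; first by rewrite -fF; apply: CA; exact/principal_filterP.
by rewrite -fG; apply: DB; exact/principal_filterP.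
Qed.

Definition le_RK (u v : betaomega) : Prop :=
  exists (f : nat -> nat) (F : betaomega -> betaomega),
    is_stone_ext (principal \o f) F /\ F v = u.

Section StoneCech.
Variables (K : realType) (X : topologicalType).

Definition unit_functions : set (X -> K) :=
  [set g : X -> K | continuous g /\ forall x, 0 <= g x <= 1].

Definition cube_eval (x : X) : {ptws unit_functions -> K} :=
  fun g => set_val g x.

(** The closure of the image of [X] in the cube of all continuous functions
    from [X] to the unit interval.  The cube is taken inside the product of
    copies of [K], in which it is closed. *)
Definition stone_cech : topologicalType := set_type (closure (range cube_eval)).

Lemma stone_cech_emb_subproof x : cube_eval x \in closure (range cube_eval).
Proof. by apply/mem_set/subset_closure; exists x. Qed.

Definition stone_cech_emb (x : X) : stone_cech :=
  exist _ (cube_eval x) (stone_cech_emb_subproof x).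

End StoneCech.

Lemma stone_cech_hausdorff (K : realType) (X : topologicalType) :
  hausdorff_space (stone_cech K X).
Proof.
move=> p q cl; apply: val_inj.
have hP : hausdorff_space {ptws (@unit_functions K X) -> K}.
  by apply: (@hausdorff_product {classic _} (fun=> K)) => ?; exact: Rhausdorff.
apply: hP => A B pA qB.
have [||x [? ?]] := cl (set_val @^-1` A) (set_val @^-1` B).
- exact: initial_continuous.
- exact: initial_continuous.
by exists (set_val x).
Qed.

Lemma stone_cech_compact (K : realType) (X : topologicalType) :
  compact [set: stone_cech K X].
Proof.
pose P := {ptws (@unit_functions K X) -> K}.
pose Q : set P := [set f | forall i, `[0 : K, 1]%classic (f i)].
have cQ : compact Q.
  apply: (@tychonoff {classic _} (fun=> K) (fun=> `[0, 1]%classic)) => i.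
  exact: segment_compact.
have hP : hausdorff_space P.
  by apply: (@hausdorff_product {classic _} (fun=> K)) => ?; exact: Rhausdorff.
have cE : compact (closure (range (@cube_eval K X))).
  apply: (subclosed_compact _ cQ); first exact: closed_closure.
  rewrite [X in _ `<=` X](closure_id Q).1; last exact: compact_closed.
  apply: closureS => _ [x _ <-] i; rewrite /= in_itv /=.
  exact: (set_valP i).2.
move=> F FF _.
have [|p [Ep clp]] := cE (set_val @ F) (fmap_proper_filter _ FF).
  apply: (@filterS _ F _ setT); last exact: filterT.
  by move=> q _; exact: set_valP.
exists (exist _ p (mem_set Ep)); split=> // A B FA [_ [[V oV <-] /= Vp VB]].
have [||_ [[q Aq <-] Vq]] := clp (set_val @` A) V.
- by apply: (@filterS _ F _ A _ _ FA) => q Aq; exists q.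
- exact: open_nbhs_nbhs.
by exists q; split=> //; exact: VB.
Qed.

Definition tychonoff_space (X : topologicalType) : Prop :=
  hausdorff_space X /\ completely_regular_space X.

(** The continuous extension of [f], viewed as a map into the compactification
    of [X], sends [u] into [X]. *)
Definition u_compact (K : realType) (u : betaomega) (X : topologicalType) :
    Prop :=
  forall (f : nat -> X) (F : betaomega -> stone_cech K X),
    is_stone_ext (@stone_cech_emb K X \o f) F ->
    range (@stone_cech_emb K X) (F u).

Definition le_C (K : realType) (u v : betaomega) : Prop :=
  forall X : topologicalType,
    tychonoff_space X -> u_compact K v X -> u_compact K u X.

(** [aleph_1] is the least uncountable cardinal. *)
Definition is_aleph1 (W : Type) : Prop :=
  ~ countable [set: W] /\
  forall V : Type, ~ countable [set: V] -> [set: W] #<= [set: V].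

Definition card_le_aleph1 (T : Type) : Prop :=
  exists W : Type, is_aleph1 W /\ [set: T] #<= [set: W].

(* Main.v *)
(** Kunen's argument for weak P-points, carried out for 2^aleph0 filters at
    once along an independent linked matrix, yields ultrafilters u_z such that
    each u_z has a set C_z containing it, disjoint from the principal
    ultrafilters, whose complement is closed under u_y-limits for all y <> z:
    an OK condition on the filter of C_z excludes limits of free ultrafilters,
    and a separation condition excludes Rudin-Keisler images of u_y.
    One never needs to decide sets along the construction, so any ultrafilters
    extending the filters obtained will do.

    Let p be one further ultrafilter of this kind.  For x in X choose finite
    sets F_x(n) below x, with x in F_x(n) and F_y(n) contained in F_x(n) for
    large n whenever y <= x; this is where |X| <= aleph_1 is used.  Let e(x) be
    the p-limit of the tensor products of the u_y, y in F_x(n).  Projections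
    give e(y) <=_RK e(x) for y <= x.  If z is not below x, the complement of C_z
    is closed under e(x)-limits, but not under e(z)-limits as u_z <=_RK e(z), and
    as a subspace of the space of ultrafilters it refutes e(z) <=_C e(x). *)
Require Import Defs.
From HB Require Import structures.
From mathcomp Require Import all_boot all_order all_algebra.
From mathcomp Require Import all_classical all_reals all_analysis.
From mathcomp Require Import finmap.
From mathcomp Require wochoice.

Set Implicit Arguments.
Unset Strict Implicit.
Unset Printing Implicit Defensive.

Import Order.TTheory GRing.Theory Num.Theory.
Import numFieldNormedType.Exports.

Local Open Scope classical_set_scope.
Local Open Scope card_scope.

(** * Well-orders with small initial segments *)

Lemma minimal_well_founded (T : Type) (lt : T -> T -> Prop) :
  (forall P : set T, P !=set0 -> exists2 x, P x & forall y, P y -> ~ lt y x) ->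
  well_founded lt.
Proof.
move=> minP x; apply: contrapT => nx.
have [|z nz zmin] := minP [set x | ~ Acc lt x]; first by exists x.
by apply: nz; constructor=> y yz; apply: contrapT => ny; exact: zmin ny yz.
Qed.

Lemma well_founded_minimal (T : Type) (lt : T -> T -> Prop) (P : set T) :
  well_founded lt -> P !=set0 -> exists2 x, P x & forall y, P y -> ~ lt y x.
Proof.
move=> wf [x Px]; apply: contrapT => nmin.
elim/(well_founded_ind wf): x Px => x IH Px.
by apply: nmin; exists x => // y Py /IH; apply.
Qed.

(* If some initial segment is as large as [T], inject [T] into the least such
   segment and pull the order back. *)
Lemma small_segments_order (T : Type) : exists lt : T -> T -> Prop,
  [/\ well_founded lt, forall x y, [\/ lt x y, x = y | lt y x],
      forall x y z, lt x y -> lt y z -> lt x z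
    & forall t, ~ ([set: T] #<= [set s | lt s t])].
Proof.
have [R Rwo] := wochoice.well_ordering_principle {classic T}.
have Ras : antisymmetric R.
  by move=> x y; exact: (wochoice.wo_chain_antisymmetric (wochoice.withinW Rwo)).
pose lt0 (x y : {classic T}) := ~~ R y x.
have min0 (P : set T) : P !=set0 -> exists2 x, P x & forall y, P y -> ~ lt0 y x.
  move=> [x Px]; have [|z [[/asboolP Pz zmin] _]] := Rwo (mem [pred x | `[<P x>]]).
    by exists x; apply/asboolP.
  by exists z => // y Py; rewrite /lt0 zmin//; apply/asboolP.
have tot0 x y : [\/ lt0 x y, x = y | lt0 y x].
  have [Rxy|] := boolP (R x y); last by constructor 3.
  have [Ryx|] := boolP (R y x); last by constructor 1.
  by constructor 2; apply: Ras; rewrite Rxy.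
have irr0 x : ~ lt0 x x.
  have [|z -> ] := min0 [set x]; first by exists x.
  by apply.
have tr0 x y z : lt0 x y -> lt0 y z -> lt0 x z.
  move=> xy yz; have [|w] := min0 [set x; y; z]; first by exists x; left; left.
  move=> [[->|->]|->] wmin; last by case: (wmin y) => //; left; right.
    case: (tot0 x z) => // [xz|zx]; last by case: (wmin z) => //; right.
    by move: yz; rewrite -xz => yx; case: (wmin y) => //; left; right.
  by case: (wmin x) => //; left; left.
have [h [hinj hsmall]] : exists h : T -> T, injective h /\
    forall t, ~ ([set: T] #<= [set s | lt0 s (h t)]).
  have [[t Tt]|nt] := pselect (exists t, [set: T] #<= [set s | lt0 s t]); last first.
    by exists id; split=> // t Tt; apply: nt; exists t.
  have [|t0 /card_leP[f] t0min] := min0 [set t | [set: T] #<= [set s | lt0 s t]].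
    by exists t.
  pose g x : [set: T] := exist _ x (mem_set I).
  exists (fun x => val (f (g x))); split.
    by move=> x y /val_inj/(@inj _ _ _ f) => /(_ (mem_set I) (mem_set I)) [].
  by move=> x /t0min; apply; exact: set_valP (f (g x)).
exists (fun x y => lt0 (h x) (h y)); split.
- apply: minimal_well_founded => P [x Px].
  have [|_ [z Pz <-] zmin] := min0 (h @` P); first by exists (h x), x.
  by exists z => // y Py; apply: zmin; exists y.
- move=> x y; case: (tot0 (h x) (h y)) => [?|/hinj->|?];
    by [constructor 1|constructor 2|constructor 3].
- by move=> x y z; exact: tr0.
- move=> t /card_le_trans tle; apply: (hsmall t); apply: tle.
  have : h @` [set s | lt0 (h s) (h t)] #= [set s | lt0 (h s) (h t)].
    by apply: inj_card_eq; exact: in2W.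
  by move=> /card_eqPle[_ /card_le_trans]; apply; apply: subset_card_le => _ [s st <-].
Qed.

(** * Coding sequences of sets; cofinality of the continuum *)

Definition decode (t : set nat) (n : nat) : set nat :=
  [set m | t (choice.pickle (n, m))].

Lemma decode_surj (g : nat -> set nat) : exists t, decode t = g.
Proof.
exists [set k | if choice.unpickle k is Some (n, m) then g n m else False].
by apply/funext => n; apply/seteqP; split=> m; rewrite /decode/= choice.pickleK.
Qed.

Lemma small_not_surj (I : set (set nat)) (k : set nat -> set nat) :
  ~ ([set: set nat] #<= I) -> exists v, forall s, I s -> k s <> v.
Proof.
move=> nI; apply: contrapT => nv; apply: nI.
apply/pcard_surjP; exists k => v _.
by apply: contrapT => nk; apply: nv; exists v => s Is ksv; apply: nk; exists s.
Qed.

(* Koenig's diagonal argument for [(2^aleph0)^aleph0 = 2^aleph0]. *)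
Lemma small_union_not_surj (I : nat -> set (set nat)) (h : nat -> set nat -> set nat) :
  (forall n, ~ ([set: set nat] #<= I n)) ->
  exists v, forall n s, I n s -> h n s <> v.
Proof.
move=> nI.
have [v vP] := choice (fun n => @small_not_surj (I n) (fun s => decode (h n s) n) (nI n)).
have [t tv] := decode_surj v.
by exists t => n s Is hv; apply: (vP n s Is); rewrite hv tv.
Qed.

Lemma infinite_powerset_nat : infinite_set [set: set nat].
Proof.
move=> /(@finite_preimage _ _ _ set1) fin.
by apply/infinite_nat/fin => m n _ _ /seteqP[/(_ m erefl)].
Qed.

(** * Kunen's independent linked family *)

(** A code is a finite guess: at each possible restriction of a row to [k] bits, a set of
    restrictions of columns. *)
Definition code := {k : nat & {ffun k.-tuple bool -> {set k.-tuple bool}}}.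

Definition restr (k : nat) (Y : set nat) : k.-tuple bool :=
  [tuple `[< Y i >] | i < k].

(** Row [Z], column [Y], level [n]. Bounding the size of the guess by [n] is what makes more than
    [n] columns of one row almost disjoint. *)
Definition matrix (Z Y : set nat) (n : nat) : set nat :=
  [set m | if (choice.pickle_inv m : option code) is Some (existT k f)
           then (#|f (restr k Z)| <= n)%N && (restr k Y \in f (restr k Z))
           else False].

Lemma matrixS (Z Y : set nat) (m n : nat) :
  (m <= n)%N -> matrix Z Y m `<=` matrix Z Y n.
Proof.
move=> mn a; rewrite /matrix/=; case: choice.pickle_inv => // -[k f].
by move=> /andP[fm ->]; rewrite (leq_trans fm mn).
Qed.

Lemma restr_inj (s : seq (set nat)) :
  exists k0, forall k, (k0 <= k)%N -> {in s &, injective (restr k)}.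
Proof.
have dP (p : set nat * set nat) : exists d, p.1 <> p.2 ->
    forall k, (d < k)%N -> restr k p.1 <> restr k p.2.
  case: p => Y Z; have [<-|YZ] := pselect (Y = Z); first by exists 0%N.
  have [d dYZ] : exists d, ~ (Y d <-> Z d).
    by apply/existsNP => YZE; apply: YZ; apply/seteqP; split=> d /YZE.
  exists d => _ k dk /(congr1 (fun t => tnth t (Ordinal dk))).
  by rewrite !tnth_mktuple => YZd; exact: dYZ (asbool_eq_equiv YZd).
have [d {}dP] := choice dP.
exists (\max_(p <- [seq (Y, Z) | Y <- s, Z <- s]) d p).+1 => k dk Y Z Ys Zs YZ.
apply: contrapT => nYZ; apply: (dP (Y, Z) nYZ k _ YZ).
apply: leq_trans dk; rewrite ltnS.
by apply: (@leq_bigmax_seq _ _ xpredT d (Y, Z)) => //; exact: allpairs_f.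
Qed.

Lemma finite_codes (k0 : nat) : finite_set [set p : code | (tag p < k0)%N].
Proof.
apply: (@sub_finite_set _ _ (\bigcup_(k in `I_k0)
  [set Tagged (fun k => {ffun k.-tuple bool -> {set k.-tuple bool}}) f
  | f in [set: {ffun k.-tuple bool -> {set k.-tuple bool}}]])).
  by move=> [k f]/= kk0; exists k => //; exists f.
apply: bigcup_finite; first exact: finite_II.
by move=> k _; exact/finite_image/finite_finset.
Qed.

(** Once [k] is large enough to tell the columns in [s] apart, their restrictions are more than [n]
    elements of a guess of size at most [n]. Only codes with small [k] remain. *)
Lemma matrix_linked (Z : set nat) (s : seq (set nat)) (n : nat) :
  uniq s -> (n < size s)%N ->
  finite_set [set m | forall Y, Y \in s -> matrix Z Y n m].
Proof.
move=> us ns; have [k0 inj] := restr_inj s.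
apply: (@sub_finite_set _ _ (choice.pickle @` [set p : code | (tag p < k0)%N])).
  move=> m /= mP; case E : (choice.pickle_inv m : option code) => [[k f]|]; last first.
    case: s us ns mP {inj} => // Y s _ _ /(_ Y (mem_head _ _)).
    by rewrite /matrix/= E.
  exists (existT _ k f) => /=; last by have := @choice.pickle_invK code m; rewrite E.
  rewrite ltnNge; apply/negP => k0k.
  case: s us ns mP inj => // Y0 s us ns mP inj.
  have := mP _ (mem_head _ _); rewrite /matrix/= E => /andP[fn _].
  have : (size (map (restr k) (Y0 :: s)) <= #|f (restr k Z)|)%N.
    rewrite -(card_uniqP _) ?map_inj_in_uniq//; last exact: inj.
    apply/subset_leq_card/fintype.subsetP => _ /mapP[Y Ys ->].
    by have := mP _ Ys; rewrite /matrix/= E => /andP[].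
  by move=> /leq_trans/(_ fn); rewrite size_map leqNgt ns.
apply: finite_image; exact: finite_codes.
Qed.

Definition cell (c : set nat -> seq (set nat)) : set nat :=
  [set m | forall i Y, Y \in c i -> matrix i Y (size (c i)) m].

Definition row_supp (c : set nat -> seq (set nat)) (r : seq (set nat)) :=
  forall i, i \notin r -> c i = [::].

(** For each large [k], guess exactly the columns [c i] at the restriction of each row [i] in [r].
    Since [k] separates these rows, the guesses do not mix and keep within the size bound. *)
Lemma infinite_cell c r : row_supp c r -> infinite_set (cell c).
Proof.
move=> cr; have [k0 inj] := restr_inj r.
pose f k : {ffun k.-tuple bool -> {set k.-tuple bool}} :=
  [ffun t => finset (fun u => has (fun i => (restr k i == t) &&
     (u \in map (restr k) (c i))) r)].
pose h n := choice.pickle (existT _ (n + k0)%N (f (n + k0)%N) : code).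
have hinj : injective h.
  by move=> m n /(pcan_inj choice.pickleK) /(congr1 (@tag _ _)) /addIn.
have hcell n : cell c (h n).
  move=> i Y Yi; rewrite /matrix/= choice.pickleK_inv ffunE.
  have ir : i \in r by apply/negPn/negP => /cr ci; rewrite ci in Yi.
  apply/andP; split; last first.
    by rewrite inE; apply/hasP; exists i => //; rewrite eqxx map_f.
  rewrite -(size_map (restr (n + k0))); apply: leq_trans (card_size _).
  apply/subset_leq_card/fintype.subsetP => u; rewrite inE => /hasP[j jr /andP[/eqP ij]].
  by have <- := inj (n + k0)%N (leq_addl _ _) _ _ jr ir ij.
move=> /(@finite_preimage _ _ _ h) fin; apply: infinite_nat.
apply: (@sub_finite_set _ _ (h @^-1` cell c)) => [n _|]; first exact: hcell.
by apply: fin; exact: in2W.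
Qed.

(** * Extending filters one condition at a time *)

(** Finite intersections of members of [G]: a base of the generated filter. *)
Inductive meets (G : set (set nat)) : set nat -> Prop :=
| meets_setT : meets G setT
| meets_setI A B : G A -> meets G B -> meets G (A `&` B).

Lemma meets_sub G G' : G `<=` G' -> meets G `<=` meets G'.
Proof. by move=> GG' V; elim=> [|A B /GG' ? _ ?]; constructor. Qed.

Lemma meetsI G A B : meets G A -> meets G B -> meets G (A `&` B).
Proof.
move=> GA GB; elim: GA => [|C D GC _ IH]; first by rewrite setTI.
by rewrite -setIA; constructor.
Qed.

Lemma meets_in (G : set (set nat)) A : G A -> meets G A.
Proof. by move=> GA; rewrite -(setIT A); do !constructor. Qed.

Lemma meets_add (G : set (set nat)) (W : set nat -> set nat) V :
  meets (G `|` range W) V ->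
  exists V0 (s : seq (set nat)), meets G V0 /\
    V0 `&` [set m | forall Y, Y \in s -> W Y m] `<=` V.
Proof.
elim=> [|A B GA _ [V0 [s [GV0 sub]]]]; first by exists setT, [::]; split; first constructor.
case: GA => [GA|[Y _ <-]].
  exists (A `&` V0), s; split; first by constructor.
  by move=> m [[Am V0m] sm]; split=> //; exact: sub.
exists V0, (Y :: s); split=> // m [V0m sm]; split; first by apply: sm; rewrite mem_head.
by apply: sub; split=> // Z Zs; apply: sm; rewrite in_cons Zs orbT.
Qed.

Lemma meets_add1 (G : set (set nat)) (A V : set nat) :
  meets (G `|` [set A]) V -> exists2 V0, meets G V0 & V0 `&` A `<=` V.
Proof.
move=> GV; have [|V0 [s [GV0 sub]]] := @meets_add G (fun=> A) V.
  by apply: meets_sub GV => B [GB|->]; [left|right; exists set0].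
by exists V0 => // m [V0m Am]; apply: sub; split.
Qed.

(** [D] holds the rows already spent; all others are still free for later conditions. *)
Definition indep (G : set (set nat)) (D : set (set nat)) :=
  forall V c r, meets G V -> row_supp c r -> (forall i, D i -> c i = [::]) ->
  infinite_set (V `&` cell c).

Lemma infinite_meets G D V : indep G D -> meets G V -> infinite_set V.
Proof.
move=> ind GV; apply: sub_infinite_set (ind V (fun=> [::]) [::] GV _ _) => //.
Qed.

Definition row_upd (c : set nat -> seq (set nat)) i s :=
  fun j => if j == i then s else c j.

Lemma cell_row_upd c i s m : c i = [::] -> cell (row_upd c i s) m ->
  cell c m /\ forall Y, Y \in s -> matrix i Y (size s) m.
Proof.
move=> ci cm; split=> [j Y Yj|Y Ys].
  by have := cm j Y; rewrite /row_upd; case: eqP => [ji|_]; [rewrite ji ci in Yj|apply].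
by have := cm i Y; rewrite /row_upd eqxx; exact.
Qed.

Lemma row_supp_upd c r i s : row_supp c r -> row_supp (row_upd c i s) (i :: r).
Proof.
by move=> cr j; rewrite in_cons negb_or /row_upd => /andP[/negPf-> /cr].
Qed.

Lemma indep_row_upd (G D : set (set nat)) i s V c r :
  indep G D -> ~ D i -> meets G V -> row_supp c r ->
  (forall j, D j \/ j = i -> c j = [::]) ->
  infinite_set (V `&` cell (row_upd c i s)).
Proof.
move=> ind nDi GV cr cD.
apply: (ind _ _ _ GV (row_supp_upd s cr)) => j Dj; rewrite /row_upd.
by case: eqP => [ji|_]; [rewrite ji in Dj|apply: cD; left].
Qed.

Definition OK_sets (V : nat -> set nat) i (Y : set nat) : set nat :=
  \bigcup_n (V n `&` matrix i Y n).

(** Kunen's OK condition, with the index shifted by one. *)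
Definition linked (V : nat -> set nat) (W : set nat -> set nat) :=
  forall n (s : seq (set nat)), uniq s -> (n < size s)%N ->
  finite_set ([set m | forall Y, Y \in s -> W Y m] `\` V n).

Lemma decreasing_le (V : nat -> set nat) :
  (forall n, V n.+1 `<=` V n) -> forall m n, (m <= n)%N -> V n `<=` V m.
Proof.
move=> Vdec m; elim=> [|n IH]; first by rewrite leqn0 => /eqP->.
by rewrite leq_eqVlt => /orP[/eqP->//|]; rewrite ltnS => /IH VV x /Vdec/VV.
Qed.

(** A point of [OK_sets V i Y] outside [V n] enters at a level at most [n], so it lies in
    [matrix i Y n], and [matrix_linked] applies. *)
Lemma linked_OK_sets V i : (forall n, V n.+1 `<=` V n) -> linked V (OK_sets V i).
Proof.
move=> Vdec n s us ns; apply: sub_finite_set (matrix_linked i us ns).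
move=> m [Wm nVm] Y Ys; have [k _ [Vk Mk]] := Wm Y Ys.
apply: matrixS Mk; rewrite leqNgt; apply/negP => nk.
by apply: nVm; apply: decreasing_le (ltnW nk) _ Vk.
Qed.

(** The new sets with indices in [s] all contain [V (size s)] cut with the columns [s] of row [i] at
    level [size s]; putting [s] in row [i] reduces to the old independence. *)
Lemma indep_OK_sets G D V i : indep G D -> ~ D i ->
  (forall n, meets G (V n)) -> indep (G `|` range (OK_sets V i)) (D `|` [set i]).
Proof.
move=> ind nDi GV V' c r /meets_add[V0 [s [GV0 sub]]] cr cD.
have inf := indep_row_upd (s := s) ind nDi (meetsI GV0 (GV (size s))) cr cD.
apply: sub_infinite_set inf => m [[V0m Vm] cm].
have [|cm' sm] := cell_row_upd _ cm; first by apply: cD; right.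
split=> //; apply: sub; split=> // Y Ys; exists (size s) => //.
by split=> //; exact: sm.
Qed.

Lemma indep_add1 (G D D' : set (set nat)) A :
  (forall V c r, meets G V -> row_supp c r -> (forall j, D' j -> c j = [::]) ->
     infinite_set (V `&` A `&` cell c)) ->
  indep (G `|` [set A]) D'.
Proof.
move=> inf V c r /meets_add1[V0 GV0 sub] cr cD.
by apply: sub_infinite_set (inf _ _ _ GV0 cr cD) => m [V0A cm]; split=> //; exact: sub.
Qed.

(* If [~` (f @^-1` A)] cannot be added to the second family, then [f @^-1` A]
   is forced modulo finitely many rows, and an almost disjoint [A'] can be
   used instead of [A]. *)
Lemma indep_separate Gz Dz Gy Dy i (f : nat -> nat) :
  indep Gz Dz -> ~ Dz i -> indep Gy Dy ->
  exists B (r : seq (set nat)), indep (Gz `|` [set B]) (Dz `|` [set i]) /\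
    indep (Gy `|` [set ~` (f @^-1` B)]) (Dy `|` [set` r]).
Proof.
move=> indz nDi indy.
pose A := matrix i set0 1; pose A' := matrix i setT 1.
have neq : (setT == set0 :> set nat) = false.
  by apply/eqP => /seteqP[/(_ 0%N I)].
have [indA|/existsNP[V']] := pselect (indep (Gy `|` [set ~` (f @^-1` A)]) Dy).
  exists A, [::]; split.
    apply: indep_add1 => // V c r GV cr cD.
    apply: sub_infinite_set (indep_row_upd (s := [:: set0]) indz nDi GV cr cD).
    move=> m [Vm /cell_row_upd[|cm /(_ set0)]]; first by apply: cD; right.
    by rewrite mem_head => /(_ isT).
  by move=> V c r GV cr cD; apply: (indA _ _ _ GV cr) => j Dj; apply: cD; left.
move=> /existsNP[c' /existsNP[r']].
move=> /not_implyP[/meets_add1[V0 GV0 sub]] /not_implyP[cr' /not_implyP[cD' /contrapT fin']].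
(* Removing [A] makes the new set disjoint from [A], not just almost disjoint: the preimage under
   [f] of the finite overlap may be infinite. *)
exists (A' `\` A), r'; split.
  apply: indep_add1 => // V c r GV cr cD.
  have finA : finite_set (A `&` A').
    apply: sub_finite_set (@matrix_linked i [:: set0; setT] 1 _ _).
    - by move=> m [Am A'm] Y; rewrite !inE => /orP[]/eqP->.
    - by rewrite /= inE eq_sym neq.
    - by [].
  apply: sub_infinite_set
    (infinite_setD (indep_row_upd (s := [:: setT]) indz nDi GV cr cD) finA).
  move=> m [[Vm cm0] nAA'].
  have [|cm /(_ setT)] := cell_row_upd _ cm0; first by apply: cD; right.
  rewrite mem_head => /(_ isT) A'm; split=> //; split=> //; split=> // Am.
  exact: nAA'.
apply: indep_add1 => // V c r GV cr cD.
(* The rows [r'] are now spent, so [c] is empty there and [c2] refines both [c] and [c']. *)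
pose c2 j := if j \in r' then c' j else c j.
have c2r : row_supp c2 (r' ++ r).
  by move=> j; rewrite mem_cat negb_or /c2 => /andP[/negPf-> /cr].
have c2D j : Dy j -> c2 j = [::].
  by move=> Dj; rewrite /c2; case: ifP => _; [exact: cD'|apply: cD; left].
have := infinite_setD (indy _ _ _ (meetsI GV GV0) c2r c2D) fin'.
apply: sub_infinite_set => m [[[Vm V0m] cm] nV'm].
have c'm : cell c' m.
  move=> j Y Yj; have jr' : j \in r' by apply/negPn/negP => /cr' E; rewrite E in Yj.
  by have := cm j Y; rewrite /c2 jr'; exact.
split.
  split=> // -[_]; apply; apply: contrapT => nA; apply: nV'm; split=> //.
  exact: sub.
move=> j Y Yj; have jr' : j \notin r'.
  by apply/negP => jr'; have E := cD j (or_intror jr'); rewrite E in Yj.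
by have := cm j Y; rewrite /c2 (negPf jr'); exact.
Qed.

(** * The transfinite construction *)

Definition family := ((set nat -> set (set nat)) * (set nat -> set (set nat)))%type.

Definition join (S S' : family) : family :=
  (fun z => S.1 z `|` S'.1 z, fun z => S.2 z `|` S'.2 z).

Definition indep_family (S : family) := forall z, indep (S.1 z) (S.2 z).

Definition selector (g : nat -> set nat) (n : nat) : nat := xget 0%N (g n).

(* A task [t] codes two indices [z = decode t 0] and [y = decode t 1], an
   irrelevant entry [decode t 2], which makes every task recur cofinally, and a
   sequence of sets, read as a function by [selector] when [z <> y]. *)
Definition task_seq (t : set nat) (n : nat) : set nat := decode t n.+3.

Definition fulfils (t : set nat) (S S' : family) :=
  let z := decode t 0 in let y := decode t 1 in let g := task_seq t in
  [/\ forall x, exists r : seq (set nat), S'.2 x `<=` [set` r],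
      indep_family (join S S'),
      z = y -> (forall n, meets (S.1 z) (g n)) -> (forall n, g n.+1 `<=` g n) ->
        exists2 W, linked g W & range W `<=` S'.1 z
    & z <> y -> exists2 B, S'.1 z B & S'.1 y (~` (selector g @^-1` B))].

Lemma fulfils_exists t S : indep_family S -> (forall z, exists i, ~ S.2 z i) ->
  exists S', fulfils t S S'.
Proof.
move=> indS avail; rewrite /fulfils.
set z := decode t 0; set y := decode t 1; set g := task_seq t.
have [i nDi] := avail z.
have join0 x : x <> z -> indep (S.1 x `|` set0) (S.2 x `|` set0).
  by move=> _; rewrite !setU0.
have [zy|zy] := pselect (z = y).
  have [[gS gdec]|ng] := pselect ((forall n, meets (S.1 z) (g n)) /\
      (forall n, g n.+1 `<=` g n)); last first.
    exists (fun=> set0, fun=> set0); split=> //=.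
    - by move=> x; exists [::].
    - by move=> x; rewrite /= !setU0.
    - by move=> _ ? ?; exfalso; apply: ng.
  exists (fun x => if x == z then range (OK_sets g i) else set0,
          fun x => if x == z then [set i] else set0); split=> //=.
  - move=> x; exists [:: i]; case: eqP => _ // j.
    by move=> ->; rewrite /= mem_head.
  - move=> x /=; case: eqP => [->|/join0//]; exact: indep_OK_sets.
  - by move=> _ _ _; exists (OK_sets g i); [exact: linked_OK_sets|rewrite eqxx].
have [B [r [indB indf]]] := indep_separate (selector g) (indS z) nDi (indS y).
have yz : (y == z) = false by apply/eqP => E; apply: zy.
exists (fun x => if x == z then [set B] else
                 if x == y then [set ~` (selector g @^-1` B)] else set0,
        fun x => if x == z then [set i] else
                 if x == y then [set` r] else set0); split=> //=.
- move=> x; exists (i :: r) => j; case: eqP => _.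
    by move=> ->; rewrite /= mem_head.
  by case: eqP => //= _; rewrite in_cons => ->; rewrite orbT.
- move=> x /=; case: eqP => [->//|xz]; case: eqP => [->//|_]; exact: join0 xz.
- by move=> _; exists B; rewrite !eqxx// yz.
Qed.

Section Stages.
Variables (lt : set nat -> set nat -> Prop) (lt_wf : well_founded lt).
Hypothesis lt_total : forall x y, [\/ lt x y, x = y | lt y x].
Hypothesis lt_trans : forall x y z, lt x y -> lt y z -> lt x z.
Hypothesis lt_small : forall t, ~ ([set: set nat] #<= [set s | lt s t]).
Variable next : set nat -> family -> family.
Hypothesis nextP : forall t S, indep_family S ->
  (forall z, exists i, ~ S.2 z i) -> fulfils t S (next t S).

(** A stage is only the increment made for task [t]; [before] and [upto] accumulate. *)
Definition stage : set nat -> family :=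
  Fix lt_wf (fun=> family) (fun t rec => next t
    (fun z => [set A | exists s (h : lt s t), (rec s h).1 z A],
     fun z => [set i | exists s (h : lt s t), (rec s h).2 z i])).

Definition before (Q : set (set nat)) : family :=
  (fun z => [set A | exists2 s, Q s & (stage s).1 z A],
   fun z => [set i | exists2 s, Q s & (stage s).2 z i]).

Lemma stageE t : stage t = next t (before [set s | lt s t]).
Proof.
rewrite {1}/stage Fix_eq; last first.
  move=> x f g fg; have -> // : f = g.
  by apply: functional_extensionality_dep => s; apply: functional_extensionality_dep => h.
rewrite /before; congr next; congr pair; apply/funext => z; apply/seteqP.
  by split=> A [s]; [move=> [h ?]; exists s|exists s; last by []].
by split=> A [s]; [move=> [h ?]; exists s|exists s; last by []].
Qed.

Definition upto t := join (before [set s | lt s t]) (stage t).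

Lemma upto1_sub t (Q : set (set nat)) z : (forall s, lt s t -> Q s) -> Q t ->
  (upto t).1 z `<=` (before Q).1 z /\ (upto t).2 z `<=` (before Q).2 z.
Proof.
move=> Qlt Qt; split=> A [[s /Qlt Qs sA]|tA]; by [exists s|exists t].
Qed.

(** Stages are linearly ordered, so finitely many members are all present at the latest of their
    stages. The empty intersection may have no stage. *)
Lemma meets_before (Q : set (set nat)) z V : meets ((before Q).1 z) V ->
  V = setT \/ exists2 s, Q s & meets ((upto s).1 z) V.
Proof.
elim=> [|A B [s Qs sA] _ IH]; [by left|right].
have upA : (upto s).1 z A by right.
case: IH => [->|[s' Qs' s'B]]; first by exists s => //; rewrite setIT; exact: meets_in.
case: (lt_total s s') => [ss'|E|s's].
- exists s' => //; constructor=> //.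
  by left; exists s.
- by subst s'; exists s => //; constructor.
- exists s => //; constructor=> //; apply: meets_sub s'B => C.
  by case=> [[s2 s2s' Cs2]|s'C]; left; [exists s2 => //; exact: lt_trans s's|exists s'].
Qed.

Lemma indep_before Q : (forall s t, Q t -> lt s t -> Q s) ->
  (forall s, Q s -> indep_family (upto s)) -> indep_family (before Q).
Proof.
move=> Qdown Qind z V c r /meets_before[->|[s Qs sV]] cr cD.
  by rewrite setTI; exact: infinite_cell cr.
apply: (Qind s Qs z _ _ _ sV cr) => i iD; apply: cD.
by have [_] := @upto1_sub s Q z (fun s' => Qdown s' s Qs) Qs; exact.
Qed.

Lemma stageP t : fulfils t (before [set s | lt s t]) (stage t).
Proof.
elim/(well_founded_ind lt_wf): t => t IH; rewrite stageE; apply: nextP.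
  apply: indep_before => [s s' s't ss'|s st]; first exact: lt_trans s't.
  by have [] := IH s st.
move=> z.
have rP s : exists r : seq (set nat), lt s t -> (stage s).2 z `<=` [set` r].
  have [st|nst] := pselect (lt s t); last by exists [::].
  by have [/(_ z)[r rP] _ _ _] := IH s st; exists r.
have [r {}rP] := choice rP.
(* Each earlier stage spends a finite list of rows. For each [n], the [n]-th rows over fewer than
   continuum many stages are too few, so some row [v] is still free. *)
have [v vP] := @small_union_not_surj (fun=> [set s | lt s t])
  (fun n s => nth set0 (r s) n) (fun=> @lt_small t).
exists v => -[s st sv]; apply: (vP (index v (r s)) s st).
by apply: nth_index; exact: rP sv.
Qed.

(** The continuum has uncountable cofinality: some value of [k] is taken at no stage up to any
    [t n], hence only later. *)
Lemma cofinal_stage (t : nat -> set nat) (k : set nat -> set nat) :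
  (forall v, exists s, k s = v) ->
  exists v, forall s, k s = v -> forall n, lt (t n) s.
Proof.
move=> ksurj.
(* Even indices exclude the stages below [t n], odd ones [t n] itself. *)
have [|v vP] := @small_union_not_surj (fun n =>
   if odd n then [set t n./2] else [set s | lt s (t n./2)]) (fun=> k).
  move=> n; case: odd; last exact: lt_small.
  by move=> /card_le_finite/(_ (finite_set1 _))/infinite_powerset_nat.
exists v => s ksv n; case: (lt_total (t n) s) => // [tn|stn].
  by exfalso; apply: (vP n.*2.+1 s _ ksv); rewrite /= odd_double/= uphalf_double.
by exfalso; apply: (vP n.*2 s _ ksv); rewrite odd_double/= doubleK.
Qed.
End Stages.

Theorem separated_families : exists G : set nat -> set (set nat),
  [/\ forall z V, meets (G z) V -> infinite_set V,
      forall z g, (forall n, meets (G z) (g n)) -> (forall n, g n.+1 `<=` g n) ->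
        exists2 W, linked g W & range W `<=` G z
    & forall z y (f : nat -> nat), z <> y ->
        exists2 B, G z B & G y (~` (f @^-1` B))].
Proof.
have [lt [wf tot tr small]] := small_segments_order (set nat).
have nextP (p : set nat * family) : exists S', indep_family p.2 ->
    (forall z, exists i, ~ p.2.2 z i) -> fulfils p.1 p.2 S'.
  have [[iS av]|nS] := pselect (indep_family p.2 /\ forall z, exists i, ~ p.2.2 z i).
    by have [S' S'P] := fulfils_exists p.1 iS av; exists S'.
  by exists p.2 => ? ?; exfalso; apply: nS.
have [next0 {}nextP] := choice nextP.
pose next t S := next0 (t, S).
have stP := @stageP lt wf tot tr small next (fun t S => nextP (t, S)).
pose G := (before wf next setT).1.
have stG t z A : (stage wf next t).1 z A -> G z A by move=> tA; exists t.
exists G; split.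
- move=> z V; apply: infinite_meets; apply: (@indep_before _ wf tot tr next setT) => // s _.
  by have [] := stP s.
- move=> z g Gg gdec.
  have sP n : exists s, g n = setT \/ meets ((upto wf next s).1 z) (g n).
    have [->|[s _ sg]] := meets_before tot tr (Gg n); first by exists set0; left.
    by exists s; right.
  have [t tP] := choice sP.
  have [|v vP] := @cofinal_stage lt tot small t (fun s => decode s 2).
    by move=> v; have [s sv] := decode_surj (fun=> v); exists s; rewrite sv.
  (* The task for the pair [z], [z] and the sequence [g]; entry [v] places it after the stages at
     which the sets [g n] are available. *)
  have [s sE] := decode_surj (fun n => if n is k.+3 then g k else if n is 2 then v else z).
  have [_ _] := stP s; rewrite /task_seq sE => /(_ erefl) H _.
  have [n|W gW WG] := H _ gdec; last by exists W => // A /WG; exact: stG.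
  case: (tP n) => [->|]; first by constructor.
  have tns : lt (t n) s by apply: vP; rewrite sE.
  apply: meets_sub => A [[s' s'tn s'A]|tnA]; last by exists (t n).
  by exists s' => //; exact: tr tns.
- move=> z y f zy.
  have [s sE] := decode_surj (fun n => if n is k.+3 then [set f k]
                                       else if n is 0 then z else y).
  have [_ _ _] := stP s; rewrite /task_seq sE => /(_ zy)[B zB yB].
  exists B; first exact: stG zB.
  suff -> : f = selector (fun n => [set f n]) by exact: stG yB.
  apply/funext => n; rewrite /selector.
  by have := xgetI 0%N (erefl : [set f n] (f n)).
Qed.

(** * Limits along ultrafilters *)

Lemma betaomega_ext (u v : betaomega) :
  ultra_sets u `<=` ultra_sets v -> u = v.
Proof.
move=> uv; have := @max_filter _ _ (ultra_setsP u) _ _ uv.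
case: u v {uv} => [u uU] [v vU] /= E; case: _ / E uU => uU.
by congr BetaOmega; exact: Prop_irrelevance.
Qed.

Lemma ultra_setVsetC (u : betaomega) A : ultra_sets u A \/ ultra_sets u (~` A).
Proof. exact: in_ultra_setVsetC. Qed.

Lemma ultra_setC (u : betaomega) A : ultra_sets u (~` A) <-> ~ ultra_sets u A.
Proof.
split=> [unA uA|nuA]; last by case: (ultra_setVsetC u A).
by have [n []] := filter_ex (filterI uA unA).
Qed.

Lemma proper_setVsetC_ultra (T : Type) (U : set_system T) :
  ProperFilter U -> (forall A, U A \/ U (~` A)) -> UltraFilter U.
Proof.
move=> PU UVC; split=> // G PG UG; apply/seteqP; split=> // A GA.
have [//|/UG GnA] := UVC A.
by have [n []] := filter_ex (filterI GA GnA).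
Qed.

(** The limit of [q] along [v], that is, the continuous extension of [q] at [v]. *)
Definition lim_sets (v : betaomega) (q : nat -> betaomega) : set_system nat :=
  [set A | ultra_sets v [set n | ultra_sets (q n) A]].

Lemma lim_ultra v q : UltraFilter (lim_sets v q).
Proof.
apply: proper_setVsetC_ultra; rewrite /lim_sets; last first.
  move=> A; have [|nA] := ultra_setVsetC v [set n | ultra_sets (q n) A]; first by left.
  by right => /=; apply: filterS nA => n /ultra_setC.
apply: Build_ProperFilter_ex => /=.
  move=> A vA; have [n nA] := @filter_ex _ (ultra_sets v) _ _ vA.
  exact: (@filter_ex _ (ultra_sets (q n)) _ _ nA).
split=> /=.
- by apply: (@filterS _ _ _ setT) filterT => n _; exact: filterT.
- by move=> A B /= vA vB; apply: filterS (filterI vA vB) => n [? ?]; exact: filterI.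
- by move=> A B AB /=; apply: filterS => n; exact: filterS.
Qed.

Definition lim v q : betaomega := BetaOmega (lim_ultra v q).

Definition image f u : betaomega := lim u (principal \o f).

Lemma principalP n A : ultra_sets (principal n) A <-> A n.
Proof. by split=> /principal_filterP. Qed.

Lemma lim_principal n q : lim (principal n) q = q n.
Proof. by apply: betaomega_ext => A /principalP. Qed.

Lemma lim_lim v w q : lim (lim v w) q = lim v (fun n => lim (w n) q).
Proof. exact: betaomega_ext. Qed.

Lemma eq_lim v q q' : ultra_sets v [set n | q n = q' n] -> lim v q = lim v q'.
Proof.
move=> vE; apply: betaomega_ext => A vA; rewrite /lim/=.
by apply: filterS (filterI vE vA) => n /= [<-].
Qed.

Lemma lim_image f u q : lim (image f u) q = lim u (q \o f).
Proof.
by rewrite lim_lim; congr lim; apply/funext => n; rewrite lim_principal.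
Qed.

Lemma image_comp f g u : image f (image g u) = image (f \o g) u.
Proof. exact: lim_image. Qed.

Lemma image_lim f v q : image f (lim v q) = lim v (image f \o q).
Proof. exact: lim_lim. Qed.

(** Equivalent to [v]-compactness of the subspace [S], by [lim_closed_u_compact] and
    [u_compact_lim_closed]. *)
Definition lim_closed (S : set betaomega) (v : betaomega) :=
  forall q, (forall n, S (q n)) -> S (lim v q).

Lemma lim_closed_principal S n : lim_closed S (principal n).
Proof. by move=> q Sq; rewrite lim_principal. Qed.

Lemma lim_closed_lim S v w : lim_closed S v -> (forall n, lim_closed S (w n)) ->
  lim_closed S (lim v w).
Proof. by move=> Sv Sw q Sq; rewrite lim_lim; apply: Sv => n; exact: Sw. Qed.

Lemma lim_closed_image S f u : lim_closed S u -> lim_closed S (image f u).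
Proof. by move=> Su q Sq; rewrite lim_image; apply: Su => n; exact: Sq. Qed.

Definition free (u : betaomega) := forall n, ~ ultra_sets u [set n].

Lemma principal_or_free u : (exists n, u = principal n) \/ free u.
Proof.
have [fu|/existsNP[n /contrapT un]] := pselect (free u); [by right|left].
exists n; apply/esym/betaomega_ext => A /principalP An.
by apply: filterS un => _ ->.
Qed.

Lemma free_finite u A : free u -> finite_set A -> ~ ultra_sets u A.
Proof.
move=> fu fA; suff : ultra_sets u (~` A) by move/ultra_setC.
have /finite_fsetP[B AB] := fA.
have -> : ~` A = \bigcap_(n in [set` B]) ~` [set n].
  rewrite AB; apply/seteqP; split=> [m nAm n An mn|m mA Am]; last exact: mA Am _.
  by rewrite mn in nAm.
by apply: filter_bigI => n _; exact/ultra_setC.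
Qed.

(** * The closed sets [carrier z] and the limits that avoid them *)

Section SeparatedUltrafilters.
Variable G : set nat -> set (set nat).
Hypothesis G_inf : forall z V, meets (G z) V -> infinite_set V.
Hypothesis G_OK : forall z g,
  (forall n, meets (G z) (g n)) -> (forall n, g n.+1 `<=` g n) ->
  exists2 W, linked g W & range W `<=` G z.
Hypothesis G_sep : forall z y (f : nat -> nat), z <> y ->
  exists2 B, G z B & G y (~` (f @^-1` B)).

Definition carrier z : set betaomega :=
  [set u | free u /\ G z `<=` ultra_sets u].

Lemma carrier_nonempty z : carrier z !=set0.
Proof.
pose F : set_system nat := [set A | exists2 V, meets (G z) V & finite_set (V `\` A)].
have PF : ProperFilter F.
  apply: Build_ProperFilter_ex.
    move=> A [V GV fVA]; apply: contrapT => A0.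
    apply: (G_inf GV); apply: sub_finite_set fVA => n Vn.
    by split=> // An; apply: A0; exists n.
  split.
  - by exists setT; [constructor|rewrite setDv].
  - move=> A B [V GV fV] [V' GV' fV']; exists (V `&` V'); first exact: meetsI.
    apply: (@sub_finite_set _ _ ((V `\` A) `|` (V' `\` B))); last by rewrite finite_setU.
    move=> n [[Vn V'n] nAB]; have [An|nAn] := pselect (A n); last by left.
    by right; split=> // Bn; exact: nAB.
  - move=> A B AB [V GV fV]; exists V => //; apply: sub_finite_set fV => n [Vn nBn].
    by split=> // /AB.
have [U [UU FU]] := ultraFilterLemma PF.
exists (BetaOmega UU); split=> [n /= Un|A GA]; last first.
  by apply: FU; exists A; [exact: meets_in|rewrite setDv].
have /ultra_setC : ultra_sets (BetaOmega UU) (~` [set n]); last exact.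
apply: FU; exists setT; first by constructor.
by rewrite setTD setCK.
Qed.

Lemma lim_closed_carrierC z y u : z <> y -> carrier y u ->
  lim_closed (~` carrier z) u.
Proof.
move=> zy [_ Gu] q qC [limfree limG].
(* If almost all [q n] are principal, the limit is an image of [u], which separation excludes. *)
have [fP|] := ultra_setVsetC u [set n | exists k, q n = principal k].
  have kP n : exists k, (exists k, q n = principal k) -> q n = principal k.
    by have [[k ?]|nk] := pselect (exists k, q n = principal k); [exists k|exists 0%N].
  have [f {}kP] := choice kP.
  have [B /limG uB /Gu unB] := G_sep f zy.
  have [n /= [[/kP qn nB] qB]] := filter_ex (filterI (filterI fP unB) uB).
  by apply: nB; move: qB; rewrite qn => /principalP.
move=> nP.
(* A free [q n] omits some member of [G z]; a principal one gets the dummy [setT]. *)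
have VP n : exists V, meets (G z) V /\
    ((forall k, q n <> principal k) -> ~ ultra_sets (q n) V).
  have [[k qk]|nk] := pselect (exists k, q n = principal k).
    by exists setT; split; [constructor|move/(_ k)].
  have [[k qk]|qfree] := principal_or_free (q n); first by case: nk; exists k.
  have [A GA nA] : exists2 A, G z A & ~ ultra_sets (q n) A.
    apply: contrapT => nA; apply: (qC n); split=> // A GA.
    by apply: contrapT => nqA; apply: nA; exists A.
  by exists A; split; first exact: meets_in.
have [V {}VP] := choice VP.
pose g := fix g n := if n is m.+1 then V n `&` g m else V 0%N.
have gV n : g n `<=` V n by case: n => [|n] m // [].
have [||W gW WG] := @G_OK z g.
- elim=> [|n IH]; first by have [] := VP 0%N.
  by apply: meetsI IH; have [] := VP n.+1.
- by move=> n m [].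
(* With [n.+1] indices in [bad n], linkedness would force [g n] into the free [q n]. So each [bad n]
   is finite, and some [W v] in [G z] lies in no free [q n]. *)
pose bad n := [set Y | (forall k, q n <> principal k) /\ ultra_sets (q n) (W Y)].
have [n fin|v vP] := @small_union_not_surj bad (fun=> id).
  apply: infinite_powerset_nat; apply: card_le_finite fin _.
  apply: contrapT => infbad.
  have [Y0 [nk _]] := infinite_setN0 infbad.
  have [[k qk]|qfree] := principal_or_free (q n); first exact: nk qk.
  have [B Bbad nB] := infinite_set_fset n.+1 infbad.
  have qB : ultra_sets (q n) (\bigcap_(Y in [set` B]) W Y).
    by apply: filter_bigI => Y /Bbad[].
  have qng : ultra_sets (q n) (~` g n).
    apply/ultra_setC => qg; have [_ /(_ nk)] := VP n; apply.
    by apply: filterS qg; exact: gV.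
  apply: (free_finite qfree _ (filterI qB qng)).
  by apply: sub_finite_set (gW n _ (fset_uniq B) nB) => m [mB mg].
have uW := limG _ (WG _ (ex_intro2 _ _ v I erefl)).
have [n [/= nk qW]] := filter_ex (filterI nP uW).
by apply: (vP n v) => //; split=> // k qk; apply: nk; exists k.
Qed.
End SeparatedUltrafilters.

(** * Finite approximations in locally countable orders *)

Section Approximations.
Variables (W : Type) (lt : W -> W -> Prop) (code_in : W -> W -> nat).
Hypothesis lt_wf : well_founded lt.
Hypothesis code_in_inj : forall a, {in [set s | lt s a] &, injective (code_in a)}.

Inductive reach (n : nat) (a : W) : set W :=
| reach_step s : lt s a -> (code_in a s < n)%N -> reach n a s
| reach_trans s s' : lt s a -> (code_in a s < n)%N -> reach n s s' -> reach n a s'.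

(** Injectivity of [code_in a] leaves finitely many single steps from [a]; induct along [lt]. *)
Lemma finite_reach n a : finite_set (reach n a).
Proof.
elim/(well_founded_ind lt_wf): a => a IH.
pose D := [set s | lt s a /\ (code_in a s < n)%N].
apply: (@sub_finite_set _ _ (\bigcup_(s in D) ([set s] `|` reach n s))).
  by move=> s [{}s sa sn|s' {}s sa sn s's]; [exists s => //; left|exists s' => //; right].
apply: bigcup_finite => [|s [sa _]]; last by rewrite finite_setU; split; last exact: IH.
have /card_eqPle[_ Dle] : code_in a @` D #= D.
  by apply: inj_card_eq => x y /set_mem[xa _] /set_mem[ya _];
    apply: code_in_inj; exact/mem_set.
apply: card_le_finite Dle _; apply: sub_finite_set (finite_II n).
by move=> _ [s [_ sn] <-].
Qed.

Lemma reach_eventually s a : lt s a -> exists N, forall n, (N <= n)%N -> reach n a s.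
Proof. by move=> sa; exists (code_in a s).+1 => n; exact: reach_step. Qed.

Lemma reach_eventually_sub s a :
  lt s a -> exists N, forall n, (N <= n)%N -> reach n s `<=` reach n a.
Proof. by move=> sa; exists (code_in a s).+1 => n cn t; exact: reach_trans. Qed.

End Approximations.

(** Segments are smaller than [W], hence countable by minimality. If a countable [B] had no strict
    bound, [W] would be the union of [B] and countably many segments. *)
Lemma aleph1_order (W : Type) : is_aleph1 W -> exists lt : W -> W -> Prop,
  [/\ well_founded lt, forall x y, [\/ lt x y, x = y | lt y x],
      forall a, countable [set s | lt s a]
    & forall B : set W, countable B -> exists a, forall b, B b -> lt b a].
Proof.
move=> [Wunc Wmin]; have [lt [wf tot _ small]] := small_segments_order W.
have segc a : countable [set s | lt s a].
  apply: contrapT => nc; apply: (small a).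
  have /card_eqPle[le1 le2] := card_setT [set s | lt s a].
  by apply: card_le_trans (Wmin _ _) le1; apply: contra_not nc; exact: card_le_trans.
exists lt; split=> // B Bc; apply: contrapT => nB; apply: Wunc.
pose F (c : bool) := if c then B else \bigcup_(b in B) [set s | lt s b].
apply: (@sub_countable _ _ _ (\bigcup_(c in [set: bool]) F c)); last first.
  apply: bigcup_countable => [|[] _ //]; first exact: countableP.
  exact: bigcup_countable.
apply: subset_card_le => a _.
have [b [Bb ab]] : exists b, B b /\ ~ lt b a.
  apply: contrapT => nb; apply: nB; exists a => b Bb.
  by apply: contrapT => nba; apply: nb; exists b.
case: (tot a b) => [ltab|->|//]; last by exists true.
by exists false => //; exists b.
Qed.

Lemma injection_of_card_le (T U : Type) :
  [set: T] #<= [set: U] -> exists f : T -> U, injective f.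
Proof.
move=> /card_leP[f]; exists (fun x => val (f (exist _ x (mem_set I)))).
by move=> x y /val_inj/(@inj _ _ _ f) => /(_ (mem_set I) (mem_set I)) [].
Qed.

Lemma finite_approximations (d : Order.disp_t) (X : porderType d) :
  card_le_aleph1 X -> (forall x : X, countable [set y : X | (y <= x)%O]) ->
  exists F : X -> nat -> seq X,
  [/\ forall x n y, y \in F x n -> (y <= x)%O,
      forall x, exists N, forall n, (N <= n)%N -> x \in F x n
    & forall x y, (y <= x)%O ->
        exists N, forall n, (N <= n)%N -> {subset F y n <= F x n}].
Proof.
move=> [W [Wa1 /injection_of_card_le[i iinj]]] Xlc.
have [lt [wf tot segc bound]] := aleph1_order Wa1.
have codeP a : exists c : W -> nat, {in [set s | lt s a] &, injective c}.
  by have /countable_injP[c cinj] := segc a; exists c.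
have [code_in {}codeP] := choice codeP.
(* Taking the least strict bound of the down-set makes [top] monotone, so [reach] from [top y] is
   eventually inside [reach] from [top x] for [y] below [x]. *)
have topP x : exists a, (forall y, (y <= x)%O -> lt (i y) a) /\
    forall a', (forall y, (y <= x)%O -> lt (i y) a') -> ~ lt a' a.
  have [|a aP] := bound (i @` [set y | (y <= x)%O]).
    exact: card_le_trans (card_image_le _ _) (Xlc x).
  have [|b bP bmin] := @well_founded_minimal _ lt
      [set b | forall y, (y <= x)%O -> lt (i y) b] wf.
    by exists a => y yx; apply: aP; exists y.
  by exists b.
have [top {}topP] := choice topP.
pose FS (p : X * nat) := [set y | (y <= p.1)%O /\ reach lt code_in p.2 (top p.1) (i y)].
have Ffin p : exists s : seq X, FS p = [set` s].
  apply/finite_seqP; apply: (@sub_finite_set _ _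
    (i @^-1` reach lt code_in p.2 (top p.1))) => [y []//|].
  by apply: finite_preimage; [exact: in2W|exact: finite_reach].
have [F FE] := choice Ffin.
have memF x n y : y \in F (x, n) <-> (y <= x)%O /\ reach lt code_in n (top x) (i y).
  by have := FE (x, n) => /seteqP[h1 h2]; split=> [/h2//|/h1].
exists (fun x n => F (x, n)); split.
- by move=> x n y /memF[].
- move=> x; have [N NP] := reach_eventually code_in ((topP x).1 x (Order.le_refl x)).
  by exists N => n /NP xn; apply/memF; split.
- move=> x y yx.
  have : top y = top x \/ lt (top y) (top x).
    case: (tot (top y) (top x)) => [|->|xy]; [by right|by left|exfalso].
    by apply: (topP y).2 _ xy => z zy; apply: (topP x).1; exact: Order.le_trans yx.
  case=> [E|/(reach_eventually_sub code_in)[N NP]].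
    by exists 0%N => n _ z /memF[zy zr]; apply/memF; rewrite -E; split=> //;
      exact: Order.le_trans yx.
  exists N => n /NP sub z /memF[zy zr]; apply/memF; split; last exact: sub.
  exact: Order.le_trans yx.
Qed.

(* Sorting along a fixed linear order turns inclusion into [subseq]. *)
Lemma subseq_approximations (d : Order.disp_t) (X : porderType d) :
  card_le_aleph1 X -> (forall x : X, countable [set y : X | (y <= x)%O]) ->
  exists F : X -> nat -> seq X,
  [/\ forall x n y, y \in F x n -> (y <= x)%O,
      forall x, exists N, forall n, (N <= n)%N -> x \in F x n
    & forall x y, (y <= x)%O ->
        exists N, forall n, (N <= n)%N -> subseq (F y n) (F x n)].
Proof.
move=> Xa1 Xlc; have [F [Fle Fin Fsub]] := finite_approximations Xa1 Xlc.
have [lt [wf tot tr _]] := small_segments_order X.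
pose R (x y : X) := `[< lt x y \/ x = y >].
have Rtot : total R.
  by move=> x y; apply/orP; case: (tot x y) => [?|->|?];
    [left; apply/asboolP; left|left; apply/asboolP; right|right; apply/asboolP; left].
have Rtr : transitive R.
  move=> y x z /asboolP[xy|->//] /asboolP[yz|<-]; apply/asboolP; left=> //.
  exact: tr yz.
have Ras : antisymmetric R.
  move=> x y /andP[/asboolP[xy|//] /asboolP[yx|//]].
  have [|z xz zmin] := @well_founded_minimal _ lt [set x; y] wf; first by exists x; left.
  by case: xz zmin => -> zmin; [case: (zmin y) => //; right|case: (zmin x) => //; left].
exists (fun x n => sort R (undup (F x n))); split.
- by move=> x n y; rewrite mem_sort mem_undup; exact: Fle.
- by move=> x; have [N NP] := Fin x; exists N => n /NP; rewrite mem_sort mem_undup.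
- move=> x y /Fsub[N NP]; exists N => n /NP sub.
  have -> : sort R (undup (F y n)) =
            sort R [seq z <- undup (F x n) | z \in F y n].
    apply/perm_sortP => //; apply: uniq_perm; rewrite ?filter_uniq ?undup_uniq//.
    move=> z; rewrite mem_filter !mem_undup; case zF : (z \in F y n) => //=.
    by rewrite sub.
  exact/subseq_sort/filter_subseq.
Qed.

(** * Tensor products of ultrafilters *)

Definition seq_of (c : nat) : seq nat := odflt [::] (choice.unpickle c).

Lemma seq_ofK : cancel (choice.pickle : seq nat -> nat) seq_of.
Proof. by move=> s; rewrite /seq_of choice.pickleK. Qed.

Definition on_seq (g : seq nat -> seq nat) (c : nat) : nat := choice.pickle (g (seq_of c)).

Lemma on_seq_comp g h : on_seq g \o on_seq h = on_seq (g \o h).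
Proof. by apply/funext => c; rewrite /on_seq/= seq_ofK. Qed.

Lemma lim_const v w : lim v (fun=> w) = w.
Proof.
apply/esym/betaomega_ext => A wA.
by apply: (@filterE _ (ultra_sets v)).
Qed.

Lemma image_id u : image id u = u.
Proof.
apply/esym/betaomega_ext => A uA.
by apply: (filterS (F := ultra_sets u) _ uA) => n ?; exact/principalP.
Qed.

Lemma image_principal f n : image f (principal n) = principal (f n).
Proof. exact: lim_principal. Qed.

Section Tensor.
Variables (X : eqType) (u : X -> betaomega).

(** An ultrafilter on coded sequences; the first coordinate is the outermost limit. *)
Fixpoint tensor (s : seq X) : betaomega :=
  if s is y :: s' then lim (u y) (fun k => image (on_seq (cons k)) (tensor s'))
  else principal (choice.pickle ([::] : seq nat)).

(** Projections pass through the iterated limits, and a dropped coordinate leaves a limit of a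
    constant. *)
Lemma tensor_mask m s : size m = size s ->
  image (on_seq (mask m)) (tensor s) = tensor (mask m s).
Proof.
elim: m s => [|b m IH] [|y s]//= => [_|[sz]].
  by rewrite image_principal /on_seq seq_ofK.
rewrite image_lim; case: b => /=.
  rewrite -IH//; congr lim; apply/funext => k /=.
  by rewrite !image_comp !on_seq_comp; congr image.
rewrite -IH// -[RHS](lim_const (u y)); congr lim; apply/funext => k /=.
by rewrite !image_comp !on_seq_comp; congr image.
Qed.

Lemma tensor_subseq s s' : subseq s s' -> exists f, image f (tensor s') = tensor s.
Proof.
by move=> /subseqP[m sz ->]; exists (on_seq (mask m)); exact: tensor_mask.
Qed.

Lemma tensor_mem y s : y \in s -> exists f, image f (tensor s) = u y.
Proof.
rewrite -sub1seq => /tensor_subseq[f fE].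
exists ((fun c => head 0%N (seq_of c)) \o f).
rewrite -image_comp fE /= image_lim -[RHS]image_id.
congr lim; apply/funext => k /=; rewrite !image_principal /on_seq !seq_ofK//=.
Qed.

Lemma lim_closed_tensor S s : (forall y, y \in s -> lim_closed S (u y)) ->
  lim_closed S (tensor s).
Proof.
elim: s => [_|y s IH] Su; first exact: lim_closed_principal.
apply: lim_closed_lim => [|k]; first by apply: Su; rewrite mem_head.
by apply: lim_closed_image; apply: IH => z zs; apply: Su; rewrite in_cons zs orbT.
Qed.

End Tensor.

Definition tag_by (n c : nat) : nat := choice.pickle (n, c).

Lemma free_cofinite p N : free p -> ultra_sets p [set n | (N <= n)%N].
Proof.
move=> fp; have -> : [set n | (N <= n)%N] = ~` `I_N.
  by apply/seteqP; split=> n /=; rewrite (leqNgt N) => /negP.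
by apply/ultra_setC/free_finite => //; exact: finite_II.
Qed.

(** Tags put the [v n] on disjoint copies of the integers, so that maps chosen for each [n] glue to
    a single map. *)
Definition tagged_lim p v := lim p (fun n => image (tag_by n) (v n)).

Lemma image_tagged_lim p (v w : nat -> betaomega) N : free p ->
  (forall n, (N <= n)%N -> exists f, image f (v n) = w n) ->
  exists f, image f (tagged_lim p v) = lim p w.
Proof.
move=> fp vw.
have fP n : exists f, (N <= n)%N -> image f (v n) = w n.
  by have [/vw[f ?]|?] := boolP (N <= n)%N; [exists f|exists id].
have [f {}fP] := choice fP.
exists (fun c => if choice.unpickle c is Some (n, c') then f n c' else 0%N).
rewrite image_lim; apply: eq_lim; apply: filterS (free_cofinite N fp) => n /= Nn.
rewrite image_comp -fP//; congr image; apply/funext => c /=.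
by rewrite /tag_by choice.pickleK.
Qed.

Lemma tagged_lim_image p (v w : nat -> betaomega) N : free p ->
  (forall n, (N <= n)%N -> exists f, image f (v n) = w n) ->
  exists f, image f (tagged_lim p v) = tagged_lim p w.
Proof.
move=> fp vw; apply: (image_tagged_lim (N := N) fp) => n /vw[f <-].
by exists (tag_by n \o f); rewrite image_comp.
Qed.

(** * Subspaces of the space of ultrafilters *)

Lemma lim_cvg v q : q @ ultra_sets v --> lim v q.
Proof.
move=> V /nbhs_betaomegaP[A vA AV].
by apply: (filterS (F := ultra_sets v) _ vA) => n qA; exact: AV.
Qed.

Lemma le_RK_image f v : le_RK (image f v) v.
Proof.
have [F [Fext Fcvg]] := stone_ext_exists (principal \o f)
  betaomega_hausdorff betaomega_compact.
exists f, F; split=> //; apply: betaomega_hausdorff => A B /Fcvg vA /lim_cvg vB.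
have [n [? ?]] := filter_ex (filterI vA vB).
by exists n.
Qed.

Section Subspace.
Local Open Scope ring_scope.
Variables (K : realType) (S : set betaomega).
Let Y : topologicalType := set_type S.

Lemma nbhs_subspaceP (r : Y) (V : set Y) : nbhs r V <->
  exists2 A, ultra_sets (val r) A & forall y : Y, ultra_sets (val y) A -> V y.
Proof.
split=> [[_ [[U oU <-] /= Ur UV]]|[A rA AV]].
  have /nbhs_betaomegaP[A rA AU] : nbhs (val r) U by exact: open_nbhs_nbhs.
  by exists A => // y yA; apply: UV; exact: AU.
exists (val @^-1` basic_open A); split=> //.
by exists (basic_open A) => //; exact: open_basic_open.
Qed.

Definition two_valued (A : set nat) (a b : K) (y : Y) : K :=
  if `[< ultra_sets (val y) A >] then a else b.

Lemma two_valued_continuous A a b : continuous (two_valued A a b).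
Proof.
move=> y V; rewrite /two_valued; case: asboolP => yA /nbhs_singleton V1.
  by apply/nbhs_subspaceP; exists A => // z zA; rewrite /= asboolT.
apply/nbhs_subspaceP; exists (~` A); first exact/ultra_setC.
by move=> z /ultra_setC zA; rewrite /= asboolF.
Qed.

Lemma subspace_tychonoff : tychonoff_space Y.
Proof.
split.
  move=> p q pq; apply/val_inj/betaomega_hausdorff => A B pA qB.
  have /pq : nbhs p (val @^-1` A) by exact: initial_continuous.
  move=> /(_ (val @^-1` B))[|y [? ?]]; first exact: initial_continuous.
  by exists (val y).
move=> y B clB nBy; apply/(@uniform_separatorP _ K).
have /nbhs_subspaceP[A yA AB] : nbhs y (~` B).
  by apply: open_nbhs_nbhs; split=> //; exact: closed_openC.
exists (two_valued A 0 1); split.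
- exact: two_valued_continuous.
- move=> _ [z _ <-]; rewrite /two_valued/= in_itv/=.
  by case: ifP; rewrite lexx ler01.
- by move=> _ [_ -> <-]; rewrite /two_valued asboolT.
- by move=> _ [z Bz <-]; rewrite /two_valued asboolF// => /AB.
Qed.

Lemma stone_coordinate_continuous (F : betaomega -> stone_cech K Y) g :
  continuous F -> continuous (fun w => set_val (F w) g).
Proof.
move=> cF w; apply: (@continuous_comp _ _ _ (set_val \o F) (fun h => h g)).
  apply: continuous_comp; first exact: cF.
  exact: initial_continuous.
exact: proj_continuous.
Qed.

Lemma ultra_near_coordinate (f : nat -> Y) (F : betaomega -> stone_cech K Y) v g V :
  is_stone_ext (@stone_cech_emb K Y \o f) F ->
  nbhs (set_val (F v) g) V -> ultra_sets v [set n | V (set_val g (f n))].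
Proof.
move=> [cF fF] FV.
have /nbhs_betaomegaP[A vA AV] := stone_coordinate_continuous (g := g) cF (x := v) FV.
apply: filterS vA => n An.
by have := AV (principal n) ((principalP n A).2 An); rewrite /= fF.
Qed.

(** The limit [r] of [f] along [v] lies in [S]. At both [r] and [F v], each coordinate [g] equals
    the limit of [g (f n)] along [v]. *)
Lemma lim_closed_u_compact v : lim_closed S v -> u_compact K v Y.
Proof.
move=> Sv f F Fext.
have Sl : S (lim v (val \o f)) by apply: Sv => n; exact: set_valP.
pose r : Y := SigSub (mem_set Sl).
exists r => //; apply/val_inj/funext => g; apply: Rhausdorff => A B rA FB.
have /nbhs_subspaceP[C rC CB] : nbhs r (set_val g @^-1` A) by exact: (set_valP g).1.
have vC : ultra_sets v [set n | ultra_sets (val (f n)) C] := rC.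
have [n [An Bn]] := filter_ex (filterI vC (ultra_near_coordinate Fext FB)).
by exists (set_val g (f n)); split=> //; exact: CB.
Qed.

(** If [F u] is the point [r], then for [A] in [r] the indicator of [A] is positive at [f n] for
    [u]-almost all [n], so [A] is in the limit. *)
Lemma u_compact_lim_closed u : u_compact K u Y -> lim_closed S u.
Proof.
move=> uY q Sq; pose f n : Y := SigSub (mem_set (Sq n)).
have [F [Fext _]] := stone_ext_exists (@stone_cech_emb K Y \o f)
  (@stone_cech_hausdorff K Y) (@stone_cech_compact K Y).
have [r _ rE] := uY f F Fext.
suff <- : val r = lim u q by exact: set_valP.
apply: betaomega_ext => A rA.
have gP : @unit_functions K Y (two_valued A 1 0).
  split=> [|y]; first exact: two_valued_continuous.
  by rewrite /two_valued; case: ifP; rewrite lexx ler01.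
pose g : @unit_functions K Y := SigSub (mem_set gP).
have FV : nbhs (set_val (F u) g) [set x : K | 0 < x].
  have -> : set_val (F u) g = two_valued A 1 0 r by rewrite -rE.
  rewrite /two_valued asboolT//; exact: lt_nbhsr.
apply: filterS (ultra_near_coordinate Fext FV) => n /=.
have -> : set_val g (f n) = two_valued A 1 0 (f n) by [].
by rewrite /two_valued; case: asboolP => //; rewrite ltxx.
Qed.

Lemma le_C_lim_closed u v : le_C K u v -> lim_closed S v -> lim_closed S u.
Proof.
move=> uv Sv; apply/u_compact_lim_closed/uv; first exact: subspace_tychonoff.
exact: lim_closed_u_compact.
Qed.

End Subspace.

(** * Assembling the embedding *)

Theorem corollary2 (K : realType) (R : betaomega -> betaomega -> Prop)
  (RK_sub_R : forall u v : betaomega, le_RK u v -> R u v)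
  (R_sub_C : forall u v : betaomega, R u v -> le_C K u v)
  (d : Order.disp_t) (X : porderType d)
  (X_le_aleph1 : card_le_aleph1 X)
  (X_locally_countable : forall x : X, countable [set y : X | (y <= x)%O]) :
  exists e : X -> betaomega,
    injective e /\ forall x y : X, (x <= y)%O <-> R (e x) (e y).
Proof.
have [G [G_inf G_OK G_sep]] := separated_families.
have [u uC] := choice (carrier_nonempty G_inf).
(* Cantor's diagonal gives [aleph_1] at most the continuum; the index [set0] is reserved for [p]. *)
have [j [jinj jn0]] : exists j : X -> set nat, injective j /\ forall x, j x <> set0.
  have [W [[_ Wmin] XW]] := X_le_aleph1.
  have : [set: W] #<= [set: set nat].
    apply: Wmin => /pcard_surjP[k ksurj].
    have [n _ kn] := ksurj [set n | ~ k n n] I.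
    have nkn : ~ k n n by move=> knn; have := knn; rewrite {1}kn.
    by move: (nkn); apply; rewrite kn.
  move=> /(card_le_trans XW)/injection_of_card_le[j jinj].
  exists (fun x => [set n | if n is m.+1 then j x m else True]); split=> [x y E|x].
    by apply: jinj; apply/funext => n; have := congr1 (fun A => A n.+1) E.
  by move=> /seteqP[/(_ 0%N I)].
have [F [Fle Fin Fsub]] := subseq_approximations X_le_aleph1 X_locally_countable.
pose p := u set0; have pfree : free p by case: (uC set0).
pose e x := tagged_lim p (fun n => tensor (u \o j) (F x n)).
have e_mono x y : (x <= y)%O -> R (e x) (e y).
  move=> /Fsub[N NP]; apply: RK_sub_R.
  have [n /NP/tensor_subseq//|f fE] := @tagged_lim_image p
    (fun n => tensor (u \o j) (F y n)) (fun n => tensor (u \o j) (F x n)) N pfree.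
  rewrite /e -fE; exact: le_RK_image.
have e_closed z x : ~ (z <= x)%O -> lim_closed (~` carrier G (j z)) (e x).
  move=> zx; apply: lim_closed_lim => [|n].
    exact: (lim_closed_carrierC G_OK G_sep (@jn0 z) (uC set0)).
  apply: lim_closed_image; apply: lim_closed_tensor => y /Fle yx.
  apply: (lim_closed_carrierC G_OK G_sep _ (uC (j y))) => /jinj zy.
  by apply: zx; rewrite zy.
have e_notclosed z : ~ lim_closed (~` carrier G (j z)) (e z).
  have [N NP] := Fin z.
  have [n /NP/tensor_mem//|f fE] := @image_tagged_lim p
    (fun n => tensor (u \o j) (F z n)) (fun=> u (j z)) N pfree.
  (* Principal ultrafilters lie outside the carrier, yet their limit [u (j z)] along [e z] lies in
     it. *)
  have ef : lim (e z) (principal \o f) = u (j z) by exact: etrans fE (lim_const _ _).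
  move=> /(_ (principal \o f)); rewrite ef => H; apply: H (uC (j z)) => n [nfree _].
  by apply: (nfree (f n)); exact/principalP.
have e_iff x y : (x <= y)%O <-> R (e x) (e y).
  split=> [/e_mono//|/R_sub_C exy]; apply: contrapT => /e_closed/(le_C_lim_closed exy).
  exact: e_notclosed.
exists e; split=> // x y exy; apply: Order.le_anti.
by apply/andP; split; apply/e_iff; rewrite exy; apply/e_iff.
Qed.
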